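(* Let $(A,\cdot_A,D)$ and $(A^*,\cdot_{A^*},Q^* )$ be commutative differential algebras (where $Q:A\to A$ is linear with transpose $Q^*$). Suppose that $((B,\cdot,D+Q^* ),(A,\cdot_A,D),(A^*,\cdot_{A^*},Q^* ))$ is a double construction of a commutative differential Frobenius algebra. For $q\in\mathbf{k}$ equip $B$ with the Novikov algebra structure induced from the admissible commutative differential algebra $(B,\cdot,D+Q^*,Q+D^* )$, i.e. $x\circ_q y=x\cdot\big((D+Q^* )+q(Q+D^* )\big)(y)$, equip $A$ with $a\circ_q b=a\cdot_A(D+qQ)(b)$, and equip $A^*$ with $f\circ^*_q g=f\cdot_{A^*}(Q^*+qD^* )(g)$. Then the triple $(B,(A,\circ_q),(A^*,\circ^*_q))$ is a Manin triple of Novikov algebras if and only if $q=-\frac12$, or $Q$ is a derivation on $(A,\cdot_A)$ and $D^*$ is a derivation on $(A^*,\cdot_{A^*})$.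
   Context: $\mathbf{k}$ is a field of characteristic $0$; all vector spaces are over $\mathbf{k}$ and finite-dimensional. For a linear map $\varphi:V\to W$, $\varphi^*:W^*\to V^*$ is the transpose, $\langle\varphi^*(f),v\rangle=\langle f,\varphi(v)\rangle$. On $A\oplus A^*$, $D+Q^*$ denotes the map $a+f\mapsto D(a)+Q^*(f)$, and $Q+D^*$ the map $a+f\mapsto Q(a)+D^*(f)$. A commutative differential algebra $(A,\cdot,D)$ is a commutative associative algebra with a derivation $D$. It is an admissible commutative differential algebra $(A,\cdot,D,Q)$ if $Q:A\to A$ is linear with $Q(a\cdot b)=Q(a)\cdot b-a\cdot D(b)$; then $a\circ_q b:=a\cdot(D+qQ)(b)$ is a Novikov product, called induced from $(A,\cdot,D,Q)$. Novikov algebra $(A,\circ)$: $(a\circ b)\circ c-a\circ(b\circ c)=(b\circ a)\circ c-b\circ(a\circ c)$ and $(a\circ b)\circ c=(a\circ c)\circ b$; put $a\star b=a\circ b+b\circ a$. A bilinear form $\mathcal{B}$ on a Novikov algebra is invariant if $\mathcal{B}(a\circ b,c)=-\mathcal{B}(b,a\star c)$; on an associative algebra it is invariant if $\mathcal{B}(a\cdot b,c)=\mathcal{B}(a,b\cdot c)$. On $B=A\oplus A^*$ consider the bilinear form $\mathcal{B}(a+f,b+g)=\langle f,b\rangle+\langle g,a\rangle$. A (standard) Manin triple of Novikov algebras is a triple $(B,(A,\circ_A),(A^*,\circ_{A^*}))$ of Novikov algebras such that $B=A\oplus A^*$ as a vector space, $(A,\circ_A)$ and $(A^*,\circ_{A^*})$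 are Novikov subalgebras of $B$, and the form $\mathcal{B}$ above is invariant on $B$. A double construction of a commutative differential Frobenius algebra associated with commutative differential algebras $(A,\cdot_A,D)$ and $(A^*,\cdot_{A^*},Q^* )$, denoted $((B,\cdot,D+Q^* ),(A,\cdot_A,D),(A^*,\cdot_{A^*},Q^* ))$, consists of a commutative associative algebra $(B,\cdot)$ with $B=A\oplus A^*$ as a vector space, containing $(A,\cdot_A)$ and $(A^*,\cdot_{A^*})$ as subalgebras, such that the form $\mathcal{B}$ above is invariant on $(B,\cdot)$ and $(B,\cdot,D+Q^* )$ is a commutative differential algebra. In this situation it is known that $Q+D^*$ is the adjoint of $D+Q^*$ with respect to $\mathcal{B}$, and that $(B,\cdot,D+Q^*,Q+D^* )$, $(A,\cdot_A,D,Q)$ and $(A^*,\cdot_{A^*},Q^*,D^* )$ are admissible commutative differential algebras. *)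

(* Defs.v *)
From HB Require Import structures.
From mathcomp Require Import all_boot all_algebra.

Set Implicit Arguments.
Unset Strict Implicit.
Unset Printing Implicit Defensive.

Import GRing.Theory.
Local Open Scope ring_scope.

(* The library's algebra structures are unital, so the possibly non-unital
   algebras considered here are vector spaces together with a product
   [mul : V -> V -> V] and predicates on it. *)

Section Algebras.
Variables (k : fieldType) (V : vectType k).
Implicit Types (mul op : V -> V -> V) (D E : V -> V) (form : V -> V -> k).

Definition bilinear_product mul : Prop := bilinear_for *:%R *:%R mul.

Record comm_assoc_algebra mul : Prop := {
  comm_assoc_bilinear : bilinear_product mul;
  comm_assoc_assoc : associative mul;
  comm_assoc_comm : commutative mul }.

Definition derivation mul D : Prop :=
  linear D /\ forall a b, D (mul a b) = mul (D a) b + mul a (D b).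

Record comm_diff_algebra mul D : Prop := {
  comm_diff_comm_assoc : comm_assoc_algebra mul;
  comm_diff_derivation : derivation mul D }.

Definition assoc_invariant mul form : Prop :=
  forall a b c, form (mul a b) c = form a (mul b c).

Record novikov_algebra op : Prop := {
  novikov_bilinear : bilinear_product op;
  novikov_left_symmetric : forall a b c,
    op (op a b) c - op a (op b c) = op (op b a) c - op b (op a c);
  novikov_right_commutative : forall a b c, op (op a b) c = op (op a c) b }.

Definition star op (a b : V) : V := op a b + op b a.

Definition novikov_invariant op form : Prop :=
  forall a b c, form (op a b) c = - form b (star op a c).

(* [a o_q b = a . (D + q E)(b)] *)
Definition induced_product mul D E (q : k) (a b : V) : V :=
  mul a (D b + q *: E b).

End Algebras.

Definition lin_dual (k : fieldType) (V : vectType k) : vectType k := 'Hom(V, k^o).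

Section Transpose.
Variables (k : fieldType) (V W : vectType k).

Definition transpose_fun (phi : 'Hom(V, W)) (f : lin_dual W) : lin_dual V :=
  (f \o phi)%VF.

Lemma transpose_fun_is_linear phi : linear (transpose_fun phi).
Proof. by move=> c f g; rewrite /transpose_fun comp_lfunDl comp_lfunZl. Qed.

HB.instance Definition _ (phi : 'Hom(V, W)) :=
  GRing.isLinear.Build k (lin_dual W) (lin_dual V) *:%R (transpose_fun phi)
    (transpose_fun_is_linear phi).

Definition transpose (phi : 'Hom(V, W)) : 'Hom(lin_dual W, lin_dual V) :=
  linfun (transpose_fun phi).

Lemma transposeE phi (f : lin_dual W) (v : V) : transpose phi f v = f (phi v).
Proof. by rewrite lfunE /= comp_lfunE. Qed.

End Transpose.

Section DirectSum.
Variables (k : fieldType) (A : vectType k).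

Definition dsum : vectType k := (A * lin_dual A)%type.

Definition dsum_inl (a : A) : dsum := (a, 0).
Definition dsum_inr (f : lin_dual A) : dsum := (0, f).

(* [S + T : a + f |-> S a + T f] *)
Definition dsum_map (S : A -> A) (T : lin_dual A -> lin_dual A) (x : dsum) :
  dsum := (S x.1, T x.2).

(* [B(a + f, b + g) = <f, b> + <g, a>] *)
Definition dsum_form (x y : dsum) : k := x.2 y.1 + y.2 x.1.

Definition dsum_subalgebras (opB : dsum -> dsum -> dsum)
    (opA : A -> A -> A) (opA' : lin_dual A -> lin_dual A -> lin_dual A) : Prop :=
  (forall a b, opB (dsum_inl a) (dsum_inl b) = dsum_inl (opA a b)) /\
  (forall f g, opB (dsum_inr f) (dsum_inr g) = dsum_inr (opA' f g)).

Record manin_triple_novikov (opB : dsum -> dsum -> dsum)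
    (opA : A -> A -> A) (opA' : lin_dual A -> lin_dual A -> lin_dual A) : Prop := {
  manin_novikov_sum : novikov_algebra opB;
  manin_novikov_left : novikov_algebra opA;
  manin_novikov_right : novikov_algebra opA';
  manin_subalgebras : dsum_subalgebras opB opA opA';
  manin_invariant : novikov_invariant opB dsum_form }.

Record double_construction (mulB : dsum -> dsum -> dsum)
    (mulA : A -> A -> A) (mulA' : lin_dual A -> lin_dual A -> lin_dual A)
    (D Q : 'End(A)) : Prop := {
  double_constr_left : comm_diff_algebra mulA D;
  double_constr_right : comm_diff_algebra mulA' (transpose Q);
  double_constr_sum :
    comm_diff_algebra mulB (dsum_map D (transpose Q));
  double_constr_subalgebras : dsum_subalgebras mulB mulA mulA';
  double_constr_invariant : assoc_invariant mulB dsum_form }.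

End DirectSum.

(* Main.v *)
Require Import Defs.
From mathcomp Require Import all_boot all_algebra.

Set Implicit Arguments.
Unset Strict Implicit.

Import GRing.Theory.
Local Open Scope ring_scope.

(** Write [P] for [D + Q^*] and [S] for its adjoint [Q + D^*] on [B].
    Transposing the Leibniz rule of [P] through the invariant form shows that
    [S] is admissible, and this makes every induced product Novikov.
    Invariance of the form for the induced product amounts to
    [(1 + 2 q) x . (P y + S y) = 0] for all [x] and [y], so either
    [q = -1/2] or [x . (P y + S y)] vanishes identically. On an admissible
    algebra the latter says exactly that [S] is a derivation. If it holds on
    the two subalgebras, it holds on [B], because [P + S] is self-adjoint and
    annihilates the products [a . b = (a, 0) . (b, 0)] and [f . g]. *)

Record admissible_algebra (k : fieldType) (V : vectType k)
    (mul : V -> V -> V) (D E : V -> V) : Prop := {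
  admissible_diff : comm_diff_algebra mul D;
  admissible_linear : linear E;
  admissible_mul : forall a b, E (mul a b) = mul (E a) b - mul a (D b) }.

(** * Elementary rules for bilinear products *)

Section BilinearProduct.
Variables (k : fieldType) (V : vectType k) (mul : V -> V -> V).
Hypothesis mul_bilinear : bilinear_product mul.

Lemma bilinear_productDl a b c : mul (a + b) c = mul a c + mul b c.
Proof. by have := mul_bilinear.1 c 1 a b; rewrite /= !scale1r. Qed.

Lemma bilinear_productDr a b c : mul a (b + c) = mul a b + mul a c.
Proof. by have := mul_bilinear.2 a 1 b c; rewrite /= !scale1r. Qed.

Lemma bilinear_product0r a : mul a 0 = 0.
Proof. by apply: (addrI (mul a 0)); rewrite -bilinear_productDr !addr0. Qed.

Lemma bilinear_productZr c a b : mul a (c *: b) = c *: mul a b.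
Proof.
by have := mul_bilinear.2 a c b 0; rewrite /= bilinear_product0r !addr0.
Qed.

End BilinearProduct.

(** * Admissible algebras and their induced Novikov products *)

Section Admissible.
Variables (k : fieldType) (V : vectType k).
Variables (mul : V -> V -> V) (D E : V -> V).
Hypothesis adm : admissible_algebra mul D E.

Let mulCA := comm_diff_comm_assoc (admissible_diff adm).
Let mulL := comm_assoc_bilinear mulCA.
Let mulC := comm_assoc_comm mulCA.
Let mulA := comm_assoc_assoc mulCA.
Let derD := comm_diff_derivation (admissible_diff adm).
Let linE := admissible_linear adm.
Let mulE := admissible_mul adm.
Let mulDl := bilinear_productDl mulL.
Let mulDr := bilinear_productDr mulL.
Let mulZr := bilinear_productZr mulL.

(** Expand [E (mul a b)] and [E (mul b a)] by admissibility and equate the results. *)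
Lemma admissible_sum_sym a b : mul a (D b + E b) = mul b (D a + E a).
Proof.
have := mulE a b; rewrite mulC mulE => /(canRL (subrK _)) h.
by rewrite !mulDr (mulC a (E b)) (mulC b (E a)) h addrC addrAC subrK addrC.
Qed.

(** The terms [mul a (D b)] of the two product rules cancel, which leaves [mul b (D a + E a)]. Thus
    [D + E] commutes with every multiplication operator. *)
Lemma admissible_sum_mul a b : D (mul a b) + E (mul a b) = mul a (D b + E b).
Proof.
rewrite admissible_sum_sym mulE derD.2 mulDr [mul b (D a)]mulC [mul b (E a)]mulC.
by rewrite addrACA subrr addr0.
Qed.

(** The Leibniz rule for [E] and the admissible rule differ by exactly [mul a (D b + E b)]. *)
Lemma admissible_derivationP :
  derivation mul E <-> forall a b, mul a (D b + E b) = 0.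
Proof.
split=> [[_ derE] a b | h].
  have := derE a b; rewrite mulE => /addrI; rewrite mulDr => <-.
  by rewrite addrN.
split=> // a b; rewrite mulE; congr (_ + _).
by apply/esym/eqP; rewrite -addr_eq0 addrC -mulDr h.
Qed.

Lemma admissible_novikov q : novikov_algebra (induced_product mul D E q).
Proof.
have linD := derD.1; rewrite /induced_product; split.
- split=> [u c a b | u c a b] /=.
    exact: (mulL.1 (D u + q *: E u) c a b).
  rewrite -(mulL.2 u c) linD linE; congr (mul u _).
  by rewrite !scalerDr !scalerA (mulrC q c) addrACA.
- move=> a b c; set P := fun x => D x + q *: E x.
  rewrite -/(P c) -/(P b) -/(P a).
  (* The associator becomes a difference of two terms, each symmetric in [x] and [y]: the first by
     [admissible_sum_sym], the second by commutativity. Left symmetry follows. *)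
  have key x y : mul (mul x (P y)) (P c) - mul x (P (mul y (P c))) =
      q *: mul (P c) (mul x (D y + E y)) - mul (mul x y) (P (P c)).
    (* [W] is [(1 - q) D y . P c], the part common to [P (y . P c)] and [P y . P c]; it cancels in
       the associator. *)
    pose W := mul (D y) (P c) - q *: mul (D y) (P c).
    have -> : P (mul y (P c)) = mul y (P (P c)) + W.
      rewrite {1}/P derD.2 [mul y (P c)]mulC mulE [mul (E (P c)) y]mulC.
      rewrite [mul (P c) (D y)]mulC scalerBr [P (P c)]/P mulDr mulZr.
      by rewrite [mul (D y) _ + _]addrC addrACA.
    have PyE : mul (P y) (P c) = q *: mul (D y + E y) (P c) + W.
      rewrite /P /W mulDl [mul (q *: _) _]mulC mulZr (mulC _ (E y)) mulDl scalerDr.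
      by rewrite [RHS]addrC addrA subrK.
    rewrite [mul (P c) _]mulC -!mulA PyE !(mulDr x) mulZr opprD addrACA.
    by rewrite subrr addr0.
  rewrite !key (mulC b a) admissible_sum_sym //.
- by move=> a b c; rewrite -!mulA [mul (_ + _) _]mulC.
Qed.

End Admissible.

(** * Symmetric nondegenerate invariant forms and adjoint operators *)

Section InvariantForm.
Variables (k : fieldType) (V : vectType k).
Variables (mul : V -> V -> V) (form : V -> V -> k) (D E : V -> V).
Hypothesis form_linear : forall c x y z,
  form (c *: x + y) z = c * form x z + form y z.
Hypothesis form_sym : forall x y, form x y = form y x.
Hypothesis form_nondeg : forall x, (forall z, form x z = 0) -> x = 0.
Hypothesis adjDE : forall x y, form (D x) y = form x (E y).
Hypothesis form_inv : assoc_invariant mul form.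

Let formDl x y z : form (x + y) z = form x z + form y z.
Proof. by rewrite -(scale1r x) form_linear mul1r scale1r. Qed.

Let form0l z : form 0 z = 0.
Proof. by apply: (addrI (form 0 z)); rewrite -formDl !addr0. Qed.

Let formZl c x z : form (c *: x) z = c * form x z.
Proof. by rewrite -[c *: x]addr0 form_linear form0l addr0. Qed.

Let formDr x y z : form z (x + y) = form z x + form z y.
Proof. by rewrite form_sym formDl !(form_sym z). Qed.

Let formZr c x z : form z (c *: x) = c * form z x.
Proof. by rewrite form_sym formZl (form_sym z). Qed.

Let formBl x y z : form (x - y) z = form x z - form y z.
Proof. by rewrite -scaleN1r formDl formZl mulN1r. Qed.

Let form_inj x y : (forall z, form x z = form y z) -> x = y.
Proof.
move=> eq_xy; apply/eqP; rewrite -subr_eq0; apply/eqP/form_nondeg => z.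
by rewrite formBl eq_xy subrr.
Qed.

(** After pairing with [z], everything moves off [a], and the rule for [E] becomes
    [b . D z = D (b . z) - D b . z], the Leibniz rule of [D]. *)
Lemma adjoint_admissible :
  comm_diff_algebra mul D -> linear E -> admissible_algebra mul D E.
Proof.
move=> diffD linE; split=> // a b; apply: form_inj => z.
have [[_ mulA mulC] [_ derD]] := diffD.
have formEl x y : form (E x) y = form x (D y).
  by rewrite form_sym -adjDE form_sym.
rewrite formBl formEl !form_inv formEl derD formDr.
by rewrite [form a (mul (D b) z) + _]addrC addrK.
Qed.

Lemma adjoint_sum_self x y : form (D x + E x) y = form x (D y + E y).
Proof.
rewrite formDl formDr adjDE addrC; congr (_ + _).
by rewrite form_sym -adjDE form_sym.
Qed.

Hypothesis adm : admissible_algebra mul D E.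

(** The operator [b |-> a . (D b + E b)] is self-adjoint, because multiplication by [a] and [D + E]
    are self-adjoint and commute. *)
Lemma form_sum_mul_swap a b c :
  form (mul a (D b + E b)) c = form (mul a (D c + E c)) b.
Proof.
have mulC := comm_assoc_comm (comm_diff_comm_assoc (admissible_diff adm)).
rewrite mulC form_inv adjoint_sum_self (admissible_sum_mul adm).
exact: form_sym.
Qed.

Lemma induced_invariantP q :
  novikov_invariant (induced_product mul D E q) form <->
  forall a b, (1 + 2%:R * q) *: mul a (D b + E b) = 0.
Proof.
have [[[mulL mulA mulC] [linD derD]] linE mulE] := adm.
pose Dl := bilinear_productDr mulL; pose Zr := bilinear_productZr mulL.
(* The defect of invariance is itself a pairing with [b], so nondegeneracy turns its vanishing for
   all [b] into the vanishing of a vector. *)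
have key a b c : form (induced_product mul D E q a b) c +
    form b (star (induced_product mul D E q) a c) =
    form ((1 + 2%:R * q) *: mul a (D c + E c)) b.
  (* This splits off a symmetric part from one governed by the Leibniz rule. In [star] the two
     orders add up to [2 q a . (D c + E c)] and [(1 - q) D (a . c)]; the latter cancels against
     [adjE]. *)
  have inducedE x y : induced_product mul D E q x y =
      q *: mul x (D y + E y) + (1 - q) *: mul x (D y).
    rewrite /induced_product !Dl Zr scalerDr scalerBl scale1r.
    by rewrite [RHS]addrC addrA subrK.
  have adjE : form (induced_product mul D E q a b) c =
      form b (mul a (D c + E c) - (1 - q) *: D (mul a c)).
    rewrite /induced_product mulC form_inv formDl adjDE formZl.
    rewrite (form_sym (E b)) -(adjDE (mul a c)) (form_sym _ b) -formZr -formDr.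
    rewrite -(admissible_sum_mul adm) scalerBl scale1r opprB.
    by rewrite [D _ + E _]addrC addrACA addrN addr0.
  rewrite adjE -formDr form_sym; congr (form _ b).
  rewrite /star !inducedE (admissible_sum_sym adm c a) derD (mulC (D a)).
  rewrite [X in _ + X]addrACA -(scalerDr (1 - q)) [mul a (D c) + _]addrC.
  rewrite addrACA addNr addr0 -{1}[mul a _]scale1r -!scalerDl.
  by rewrite mulr_natl mulr2n.
split=> [inv a c | h a b c].
  by apply: form_nondeg => b; rewrite -key inv addNr.
by apply/eqP; rewrite -addr_eq0 key h form0l.
Qed.

End InvariantForm.

(** * The natural pairing on the sum of [A] and its dual *)

Section DirectSumForm.
Variables (k : fieldType) (A : vectType k).
Implicit Types x y z : dsum A.

Lemma dsum_form_linear c x y z :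
  dsum_form (c *: x + y) z = c * dsum_form x z + dsum_form y z.
Proof.
case: x y z => [a f] [b g] [u h]; rewrite /dsum_form /=.
by rewrite !lfunE /= lfunE /= linearP mulrDr addrACA.
Qed.

Lemma dsum_form_sym x y : dsum_form x y = dsum_form y x.
Proof. by rewrite /dsum_form addrC. Qed.

(** Coordinates in a basis are linear functionals, so a vector killed by all functionals has only
    zero coordinates. *)
Lemma lin_dual_separates (a : A) : (forall f : lin_dual A, f a = 0) -> a = 0.
Proof.
move=> h; rewrite (coord_vbasis (memvf a)) big1 // => i _.
have := h (linfun (coord (vbasis fullv) i : A -> k^o)).
by rewrite lfunE /= => ->; rewrite scale0r.
Qed.

Lemma dsum_form_nondeg x : (forall z, dsum_form x z = 0) -> x = 0.
Proof.
case: x => a f h; congr pair.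
  apply: lin_dual_separates => g.
  by have := h (dsum_inr g); rewrite /dsum_form /= linear0 add0r.
apply/lfunP => b; rewrite lfunE.
by have := h (dsum_inl b); rewrite /dsum_form /= lfunE addr0.
Qed.

Lemma dsum_map_adjoint (D Q : 'End(A)) x y :
  dsum_form (dsum_map D (transpose Q) x) y =
  dsum_form x (dsum_map Q (transpose D) y).
Proof. by rewrite /dsum_form /= !transposeE. Qed.

Lemma dsum_map_linear (D Q : 'End(A)) : linear (dsum_map D (transpose Q)).
Proof. by move=> c x y; rewrite /dsum_map !linearP. Qed.

End DirectSumForm.

(** * Double constructions and their two subalgebras *)

Section DoubleConstruction.
Variables (k : fieldType) (A : vectType k).
Variables (mulA : A -> A -> A) (mulA' : lin_dual A -> lin_dual A -> lin_dual A).
Variables (mulB : dsum A -> dsum A -> dsum A) (D Q : 'End(A)).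
Hypothesis dc : double_construction mulB mulA mulA' D Q.

Local Notation P := (dsum_map D (transpose Q)).
Local Notation S := (dsum_map Q (transpose D)).

Let subA := (double_constr_subalgebras dc).1.
Let subA' := (double_constr_subalgebras dc).2.

Lemma double_construction_admissible : admissible_algebra mulB P S.
Proof.
apply: (adjoint_admissible (@dsum_form_linear _ A) (@dsum_form_sym _ A)
  (@dsum_form_nondeg _ A) (dsum_map_adjoint D Q)).
- exact: double_constr_invariant dc.
- exact: double_constr_sum dc.
- exact: dsum_map_linear.
Qed.

Let dsum_map_inl (T U : 'End(A)) a :
  dsum_map T (transpose U) (dsum_inl a) = dsum_inl (T a).
Proof. by rewrite /dsum_map /= linear0. Qed.

Let dsum_map_inr (T U : 'End(A)) f :
  dsum_map T (transpose U) (dsum_inr f) = dsum_inr (transpose U f).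
Proof. by rewrite /dsum_map /= linear0. Qed.

Lemma double_construction_admissible_left : admissible_algebra mulA D Q.
Proof.
split; [exact: double_constr_left dc | by move=> c x y; rewrite linearP |].
move=> a b.
have := admissible_mul double_construction_admissible (dsum_inl a) (dsum_inl b).
by rewrite subA !dsum_map_inl !subA => /(congr1 fst).
Qed.

Lemma double_construction_admissible_right :
  admissible_algebra mulA' (transpose Q) (transpose D).
Proof.
split; [exact: double_constr_right dc | by move=> c x y; rewrite linearP |].
move=> f g.
have := admissible_mul double_construction_admissible (dsum_inr f) (dsum_inr g).
by rewrite subA' !dsum_map_inr !subA' => /(congr1 snd).
Qed.

(** [P] and [S] preserve both summands and act there as the given operators, so the induced product
    restricts as well. *)
Lemma induced_dsum_subalgebras q :
  dsum_subalgebras (induced_product mulB P S q) (induced_product mulA D Q q)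
    (induced_product mulA' (transpose Q) (transpose D) q).
Proof.
split=> [a b | f g]; rewrite /induced_product.
  rewrite !dsum_map_inl -subA; congr mulB.
  by rewrite /dsum_inl; congr pair; rewrite /= scaler0 addr0.
rewrite !dsum_map_inr -subA'; congr mulB.
by rewrite /dsum_inr; congr pair; rewrite /= scaler0 addr0.
Qed.

Lemma dsum_sum_annihilatesP :
  (forall x y, mulB x (P y + S y) = 0) <->
  derivation mulA Q /\ derivation mulA' (transpose D).
Proof.
have [[adB admA] adA'] := (double_construction_admissible,
  double_construction_admissible_left, double_construction_admissible_right).
have TE x : P x + S x = dsum_inl (D x.1 + Q x.1) +
    dsum_inr (transpose Q x.2 + transpose D x.2).
  by rewrite /dsum_inl /dsum_inr; congr pair; rewrite ?addr0 ?add0r.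
have TlE a : P (dsum_inl a) + S (dsum_inl a) = dsum_inl (D a + Q a).
  by rewrite !dsum_map_inl; congr pair; rewrite addr0.
have TrE f : P (dsum_inr f) + S (dsum_inr f) =
    dsum_inr (transpose Q f + transpose D f).
  by rewrite !dsum_map_inr; congr pair; rewrite addr0.
split=> [h | [/(admissible_derivationP admA) hA
              /(admissible_derivationP adA') hA'] x y].
  split.
    apply/(admissible_derivationP admA) => a b.
    by have := h (dsum_inl a) (dsum_inl b); rewrite TlE subA => /(congr1 fst).
  apply/(admissible_derivationP adA') => f g.
  by have := h (dsum_inr f) (dsum_inr g); rewrite TrE subA' => /(congr1 snd).
have mulBL := comm_assoc_bilinear (comm_diff_comm_assoc (admissible_diff adB)).
have dsumE z : z = dsum_inl z.1 + dsum_inr z.2.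
  by case: z => z1 z2; congr pair; rewrite /= ?addr0 ?add0r.
have hl a b : mulB (dsum_inl a) (P (dsum_inl b) + S (dsum_inl b)) = 0.
  by rewrite TlE subA hA.
have hr f g : mulB (dsum_inr f) (P (dsum_inr g) + S (dsum_inr g)) = 0.
  by rewrite TrE subA' hA'.
have form0 z : dsum_form 0 z = 0 by rewrite /dsum_form /= lfunE linear0 addr0.
have swap := form_sum_mul_swap (@dsum_form_linear _ A) (@dsum_form_sym _ A)
  (dsum_map_adjoint D Q) (double_constr_invariant dc) adB.
have formDr u v z : dsum_form z (u + v) = dsum_form z u + dsum_form z v.
  rewrite -[u]scale1r ![dsum_form z _]dsum_form_sym dsum_form_linear mul1r.
  by rewrite scale1r.
(* Mixed products are tested on each summand. Against [dsum_inl z.1], [swap] leads to [hl]; against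
   [dsum_inr z.2], symmetry first exchanges [a] and [f], and [swap] then leads to [hr]. *)
have hlr a f : mulB (dsum_inl a) (P (dsum_inr f) + S (dsum_inr f)) = 0.
  apply: dsum_form_nondeg => z; rewrite [z]dsumE formDr.
  rewrite swap hl form0 add0r (admissible_sum_sym adB).
  by rewrite swap hr form0.
(* Of the four component products, [hl] and [hr] kill the pure ones and [hlr] one mixed one; the
   other mixed one reduces to it by symmetry. *)
rewrite [x]dsumE (bilinear_productDl mulBL) TE -TlE -TrE.
rewrite !(bilinear_productDr mulBL _ (_ + _)) hl hr hlr (admissible_sum_sym adB).
by rewrite hlr !addr0.
Qed.

End DoubleConstruction.

(** * Manin triples among the induced products *)

Unset Implicit Arguments.

Theorem proposition2p37 (k : fieldType) (char0 : [pchar k] =i pred0)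
    (A : vectType k)
    (mulA : A -> A -> A) (mulA' : lin_dual A -> lin_dual A -> lin_dual A)
    (D Q : 'End(A))
    (hA : comm_diff_algebra mulA D)
    (hA' : comm_diff_algebra mulA' (transpose Q))
    (mulB : dsum A -> dsum A -> dsum A)
    (hB : double_construction mulB mulA mulA' D Q)
    (q : k) :
  manin_triple_novikov
    (induced_product mulB (dsum_map D (transpose Q))
                          (dsum_map Q (transpose D)) q)
    (induced_product mulA D Q q)
    (induced_product mulA' (transpose Q) (transpose D) q)
  <-> q = - 2%:R^-1 \/
      (derivation mulA Q /\ derivation mulA' (transpose D)).
Proof.
have adB := double_construction_admissible hB.
have charn2 : 2%:R != 0 :> k by have /pcharf0P -> := char0.
have invP := induced_invariantP (@dsum_form_linear _ A) (@dsum_form_sym _ A)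
  (@dsum_form_nondeg _ A) (dsum_map_adjoint D Q) (double_constr_invariant hB)
  adB q.
(* Characteristic zero makes 2 invertible, so the scalar in the invariance criterion has [-1/2] as
   its only root. *)
have coef0 : (1 + 2%:R * q == 0) = (q == - 2%:R^-1).
  by rewrite addrC addr_eq0 -(inj_eq (mulfI charn2) q) mulrN divff.
split=> [[_ _ _ _ /invP inv] | h].
  have [q_half | q_neq] := eqVneq q (- 2%:R^-1); first by left.
  right; apply/(dsum_sum_annihilatesP hB) => x y.
  by have /eqP := inv x y; rewrite scaler_eq0 coef0 (negPf q_neq) => /eqP.
split.
- exact: admissible_novikov.
- exact: admissible_novikov (double_construction_admissible_left hB) q.
- exact: admissible_novikov (double_construction_admissible_right hB) q.
- exact: induced_dsum_subalgebras hB q.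
- apply/invP => x y; case: h => [/eqP | /(dsum_sum_annihilatesP hB) ->].
    by rewrite -coef0 => /eqP ->; rewrite scale0r.
  exact: scaler0.
Qed.
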